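(* For a locally convex space $E$ the following conditions are equivalent: (1) each compact subset of $E$ has finite topological dimension; (2) each bounded linearly independent subset of $E$ is finite; (3) $E$ is bornologically isomorphic to a free locally convex space. If $E$ is bornological, then conditions (1)–(3) are also equivalent to (4) $E$ is free, i.e. $E$ carries the finest locally convex topology.
   Context: A subset $B$ of a topological vector space is bounded if for every neighborhood $U$ of zero there is $n\in\mathbb N$ with $B\subseteq nU$. A linear operator is bounded if it maps bounded sets to bounded sets. Two topological vector spaces $E,F$ are bornologically isomorphic if there is a linear bijection $f:E\to F$ such that $f$ and $f^{-1}$ are bounded. A locally convex space is free if it carries the finest locally convex topology (equivalently it is topologically isomorphic to the free locally convex space $L(\kappa)$ over a discrete space of cardinality $\kappa$ equal to its Hamel dimension). A locally convex space is bornological if every bounded linear operator from it into a locally convex space is continuous.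
   Formalization: The locally convex space E (over the reals) is assumed Hausdorff, the usual convention; without it the claim fails, e.g. for an infinite-dimensional space with the indiscrete topology, where (1) holds but (2) does not. *)

(* Defs.v *)
(* locally convex spaces are [tvsType R] (tvs.v). *)
From HB Require Import structures.
From mathcomp Require Import all_boot all_order all_algebra.
From mathcomp Require Import all_classical all_reals all_analysis.
Set Implicit Arguments. Unset Strict Implicit. Unset Printing Implicit Defensive.
Import Order.TTheory GRing.Theory Num.Theory.
Local Open Scope classical_set_scope.
Local Open Scope ring_scope.

Section defs.
Variable R : realType.

Definition tvs_bounded (E : tvsType R) (B : set E) : Prop :=
  forall U : set E, nbhs (0 : E) U ->
    exists n : nat, B `<=` [set n%:R *: u | u in U].

Definition bounded_op (E F : tvsType R) (f : E -> F) : Prop :=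
  forall B : set E, tvs_bounded B -> tvs_bounded (f @` B).

Definition born_iso (E F : tvsType R) : Prop :=
  exists (f : E -> F) (g : F -> E),
    [/\ linear f, cancel f g, cancel g f, bounded_op f & bounded_op g].

Definition lin_indep (E : lmodType R) (S : set E) : Prop :=
  forall (s : seq E) (c : E -> R),
    uniq s -> (forall x, x \in s -> S x) ->
    \sum_(x <- s) c x *: x = 0 -> forall x, x \in s -> c x = 0.

(** Lebesgue covering dimension of a subspace A of a topological space is
    at most n: every finite cover of A by (relatively) open sets has a
    finite (relatively) open refinement covering A of order <= n+1. *)
Definition covdim_le (T : topologicalType) (A : set T) (n : nat) : Prop :=
  forall (m : nat) (U : 'I_m -> set T),
    (forall i, open (U i)) -> A `<=` \bigcup_i U i ->
    exists (k : nat) (V : 'I_k -> set T),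
      [/\ forall j, open (V j),
          A `<=` \bigcup_j V j,
          forall j, exists i, V j `&` A `<=` U i &
          forall x, A x -> (\sum_(j < k) (`[< V j x >] : nat) <= n.+1)%N].

Definition finite_top_dim (T : topologicalType) (A : set T) : Prop :=
  exists n : nat, covdim_le A n.

Definition balanced_set (E : lmodType R) (U : set E) : Prop :=
  forall (t : R) (x : E), `|t| <= 1 -> U x -> U (t *: x).

Definition absorbing_set (E : lmodType R) (U : set E) : Prop :=
  forall x : E, exists2 r : R, 0 < r & forall t : R, `|t| <= r -> U (t *: x).

(** E is free: it carries the finest locally convex topology, i.e. every
    absorbing absolutely convex (convex and balanced) set is a 0-neighborhood. *)
Definition free_lcs (E : tvsType R) : Prop :=
  forall U : set E, convex_set U -> balanced_set U -> absorbing_set U ->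
    nbhs (0 : E) U.

Definition bornological (E : tvsType R) : Prop :=
  forall (F : tvsType R) (f : E -> F), linear f -> bounded_op f -> continuous f.

End defs.

(* Main.v *)
(* (3) => (2) and (4): in a free space the unit ball of a linear functional
   sending the n-th member of a linearly independent sequence to n is a
   neighbourhood of 0 which does not absorb that sequence; and the bijection of
   (3) is continuous when E is bornological.
   (2) => (1), (3): a maximal linearly independent subset of a bounded set is
   finite, so a bounded set lies in a finite-dimensional subspace, on which the
   topology is Euclidean.
   (1) => (2): from a bounded linearly independent sequence one builds cubes of
   every dimension shrinking to 0; together with 0 they form a compact set,
   which is infinite-dimensional by Lebesgue's covering theorem.  The latter
   rests on a discrete Poincare-Miranda theorem, obtained modulo 2 from Stokes'
   formula for the cup product of the coboundaries of n labellings. *)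
Require Import Defs.
From HB Require Import structures.
From mathcomp Require Import all_boot all_order all_algebra.
From mathcomp Require Import all_classical all_reals all_analysis.
From mathcomp Require Import ring lra zify.
Set Implicit Arguments. Unset Strict Implicit. Unset Printing Implicit Defensive.
Import Order.TTheory GRing.Theory Num.Theory.
Import numFieldNormedType.Exports.
Local Open Scope classical_set_scope.
Local Open Scope ring_scope.

(** * The discrete Poincare-Miranda theorem *)

Section discrete_poincare_miranda.
Variables (n m : nat).
Local Notation vertex := ('I_n -> nat).
(** Cubical cochains modulo 2: the pair [v], [S] stands for the face of the grid with lowest corner
    [v] spanned by the directions in [S]. *)
Local Notation cochain := (vertex -> {set 'I_n} -> bool).

Definition upd (v : vertex) (s : 'I_n) (x : nat) : vertex :=
  fun i => if i == s then x else v i.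

Definition up (s : 'I_n) (v : vertex) : vertex := upd v s (v s).+1.

Definition coboundary (G : cochain) : cochain := fun v S =>
  \big[addb/false]_(s in S) (G (up s v) (S :\ s)%SET (+) G v (S :\ s)%SET).

(** Multiplying a closed cochain by [a], read at the lowest corner of a face, and taking the
    coboundary gives the cup product of the coboundary of [a] with that cochain. Iterating this
    yields the product of the coboundaries of all labellings. *)
Fixpoint cup (l : seq (vertex -> bool)) : cochain :=
  if l is a :: l' then coboundary (fun v S => a v && cup l' v S)
  else fun _ _ => true.

Definition cube_vertex (v : vertex) (S : {set 'I_n}) (w : vertex) : Prop :=
  forall i, (v i <= w i <= v i + (i \in S))%N.

Lemma upd_id v s x : upd v s x s = x.
Proof. by rewrite /upd eqxx. Qed.

Lemma upd_upd v s x y : upd (upd v s x) s y = upd v s y.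
Proof. by apply/funext => i; rewrite /upd; case: eqP. Qed.

Lemma upd_comm v s t x y : s != t -> upd (upd v s x) t y = upd (upd v t y) s x.
Proof.
move=> st; apply/funext => i; rewrite /upd; case: (eqVneq i t) => // ->.
by rewrite eq_sym (negPf st).
Qed.

Lemma up_comm v s t : up s (up t v) = up t (up s v).
Proof.
case: (eqVneq s t) => [->//|st]; rewrite /up.
rewrite upd_comm 1?eq_sym // /upd (negPf st) eq_sym (negPf st) //.
Qed.

(** The terms at [(s, t)] and [(t, s)] cancel modulo 2. *)
Lemma xor_offdiag (H : 'I_n -> 'I_n -> bool) (S : {set 'I_n}) :
  (forall s t, H s t = H t s) ->
  \big[addb/false]_(s in S) \big[addb/false]_(t in (S :\ s)%SET) H s t = false.
Proof.
move=> Hsym; rewrite pair_big_dep /= (bigID (fun p : 'I_n * 'I_n => p.1 < p.2)%N).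
rewrite -[LHS]/(addb _ _) [X in _ (+) X](reindex_inj (h := fun p : 'I_n * 'I_n => (p.2, p.1))) /=;
  last by move=> [? ?] [? ?] [-> ->].
rewrite [X in _ (+) X](eq_bigl (fun p : 'I_n * 'I_n => (p.1 \in S) &&
    (p.2 \in (S :\ p.1)%SET) && (p.1 < p.2)%N)); last first.
  move=> [s t] /=; rewrite !inE [t == s]eq_sym -leqNgt leq_eqVlt.
  rewrite -[(s : nat) == t]/(s == t).
  by case: (s \in S); case: (t \in S); case: eqVneq => //=; rewrite ?andbF ?andbT.
by under [X in _ (+) X]eq_bigr do rewrite Hsym; rewrite addbb.
Qed.

(** Both orders of removing two directions lead to the same four faces of codimension two, so the
    terms cancel in pairs. *)
Lemma coboundaryK G v S : coboundary (coboundary G) v S = false.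
Proof.
pose H s t := let U := (S :\ s :\ t)%SET in
  (G (up t (up s v)) U (+) G (up s v) U) (+) (G (up t v) U (+) G v U).
transitivity (\big[addb/false]_(s in S) \big[addb/false]_(t in (S :\ s)%SET) H s t).
  by apply: eq_bigr => s _; rewrite -big_split.
apply: xor_offdiag => s t; rewrite /H /= (_ : S :\ s :\ t = S :\ t :\ s)%SET; last first.
    by rewrite !finset.setDDl finset.setUC.
  by rewrite up_comm; do 4 case: (G _ _).
Qed.

Lemma cup_closed l v S : coboundary (cup l) v S = false.
Proof. by case: l => [|a l]; [exact: big1|exact: coboundaryK]. Qed.

Lemma cube_vertex_up v (S : {set 'I_n}) s w : s \in S ->
  cube_vertex (up s v) (S :\ s)%SET w -> cube_vertex v S w.
Proof.
move=> sS vw i; have := vw i; rewrite /up /upd !inE.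
by case: (eqVneq i s) => [->|] //=; rewrite sS addn0 addn1 => /andP[/ltnW->].
Qed.

Lemma cube_vertexW v (S : {set 'I_n}) s w : cube_vertex v (S :\ s)%SET w -> cube_vertex v S w.
Proof.
move=> vw i; have /andP[-> /leq_trans] := vw i; apply.
by rewrite leq_add2l !inE; case: (_ == _) => //; case: (_ \in _).
Qed.

Lemma cube_vertexx v S : cube_vertex v S v.
Proof. by move=> i; rewrite leqnn leq_addr. Qed.

(** A labelling constant on a face has zero coboundary there. As first factor it comes out as the
    constant [c] in front of the coboundary of a closed cochain; otherwise induction applies to each
    facet. *)
Lemma cup_const (I : eqType) (a : I -> vertex -> bool) l i c v S : i \in l ->
  (forall w, cube_vertex v S w -> a i w = c) -> cup (map a l) v S = false.
Proof.
elim: l v S => // j l IH v S; rewrite inE => /orP[/eqP <-|il] ac /=.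
  rewrite -[RHS](andbF c) -(cup_closed (map a l) v S) /coboundary /=.
  rewrite big_distrr /=; apply: eq_bigr => s sS.
  rewrite !ac ?andb_addr//; last exact/cube_vertex_up/cube_vertexx.
  exact: cube_vertexx.
rewrite /coboundary big1// => s sS.
rewrite !IH ?andbF// => w vw; apply: ac; first exact: cube_vertexW vw.
exact: cube_vertex_up vw.
Qed.

Definition slice_sum (s : 'I_n) (F : vertex -> bool) : vertex -> bool :=
  fun v => \big[addb/false]_(x < m) F (upd v s x).

Definition grid_sum (l : seq 'I_n) (F : vertex -> bool) : vertex -> bool :=
  foldr slice_sum F l.

Lemma slice_sumC s t F : slice_sum s (slice_sum t F) = slice_sum t (slice_sum s F).
Proof.
case: (eqVneq s t) => [->//|st]; apply/funext => v.
rewrite /slice_sum exchange_big; apply: eq_bigr => x _; apply: eq_bigr => y _.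
by rewrite upd_comm.
Qed.

Lemma grid_sum_slice s l F : grid_sum (s :: l) F = grid_sum l (slice_sum s F).
Proof. by elim: l => //= t l <-; rewrite /= slice_sumC. Qed.

Lemma grid_sum_rem s l F : s \in l ->
  grid_sum l F = grid_sum (rem s l) (slice_sum s F).
Proof.
elim: l => // t l IH; rewrite inE /= eq_sym; case: eqVneq => [->|_] /=.
  by rewrite -grid_sum_slice.
by move=> /IH ->.
Qed.

Lemma slice_telescope s F v :
  slice_sum s (fun v => F (up s v) (+) F v) v = F (upd v s m) (+) F (upd v s 0).
Proof.
rewrite /slice_sum; move: {+}m => k.
elim: k => [|k IH]; first by rewrite big_ord0 addbb.
rewrite big_ord_recr /= IH /up upd_id upd_upd.
by do 3 case: (F _).
Qed.

Lemma eq_grid_sum l F G : F =1 G -> grid_sum l F = grid_sum l G.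
Proof. by move=> /funext ->. Qed.

Lemma grid_sum_big l (S : {set 'I_n}) (F : 'I_n -> vertex -> bool) v :
  grid_sum l (fun v => \big[addb/false]_(s in S) F s v) v =
  \big[addb/false]_(s in S) grid_sum l (F s) v.
Proof.
elim: l v => // t l IH v /=; rewrite [RHS]exchange_big /=.
by apply: eq_bigr => x _; exact: IH.
Qed.

Lemma grid_sum_upd s x l F v : s \notin l ->
  grid_sum l (fun v => F (upd v s x)) v = grid_sum l F (upd v s x).
Proof.
elim: l v => // t l IH v; rewrite inE negb_or => /andP[st sl] /=.
by apply: eq_bigr => y _; rewrite IH// upd_comm// eq_sym.
Qed.

Lemma grid_sum0 l F v : (forall v, F v = false) -> grid_sum l F v = false.
Proof. by elim: l v => [|s l IH] v F0 /=; [exact: F0|apply: big1 => x _; exact: IH]. Qed.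

(** A nonzero sum modulo 2 has a nonzero term; this turns parity into existence. *)
Lemma grid_sum_true l F v : grid_sum l F v ->
  exists2 w, F w & (forall i, i \in l -> w i < m)%N /\
    (forall i, i \notin l -> w i = v i).
Proof.
elim: l v => [|s l IH] v /=; first by exists v.
move=> H; have [x] : exists x : 'I_m, grid_sum l F (upd v s x).
  apply/existsP; apply: contraTT H => /existsPn H.
  by rewrite /slice_sum big1// => x _; exact/negbTE/H.
move=> /IH[w Fw [wl wv]]; exists w => //; split=> i; rewrite inE.
  move=> /orP[/eqP ->|/wl//]; case: (boolP (s \in l)) => [/wl//|/wv ->].
  by rewrite upd_id.
by rewrite negb_or => /andP[/negPf is_ /wv ->]; rewrite /upd is_.
Qed.

Variable a : 'I_n -> vertex -> bool.
Hypothesis a0 : forall i v, v i = 0%N -> a i v = false.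
Hypothesis am : forall i v, v i = m -> a i v = true.

(* Stokes: only the face [v s0 = m] of the outermost direction contributes. *)
Lemma grid_sum_cup l v : uniq l ->
  grid_sum l (fun v => cup (map a l) v [set x in l]%SET) v.
Proof.
elim: l v => // s0 l IH v /= /andP[s0l ul].
set S := [set x in _]%SET; set G := (fun v S => _ && _).
have Ssl : (S :\ s0)%SET = [set x in l]%SET.
  apply/setP => x; rewrite !inE; case: (eqVneq x s0) => [->|]//=.
  by rewrite (negPf s0l).
rewrite -[slice_sum _ _ _]/(grid_sum (s0 :: l) (fun v => coboundary G v S) v).
rewrite [grid_sum _ _ _]grid_sum_big (bigD1 s0) /=; last by rewrite !inE eqxx.
(* Summation along direction [s] telescopes to the two outer faces, at [m] and at 0. *)
have term s : s \in s0 :: l ->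
    grid_sum (s0 :: l) (fun v => G (up s v) (S :\ s)%SET (+) G v (S :\ s)%SET) v =
    grid_sum (rem s (s0 :: l)) (fun v => G (upd v s m) (S :\ s)%SET (+)
      G (upd v s 0) (S :\ s)%SET) v.
  move=> sl; rewrite (grid_sum_rem _ sl); congr (_ v); apply: eq_grid_sum => w.
  exact: (slice_telescope s (fun v => G v (S :\ s)%SET)).
(* For [s] other than [s0], the labelling [a s] is one of the inner factors and is constant on
   either outer face, so [cup_const] kills both terms. *)
rewrite [X in _ (+) X]big1 ?addbF; last first.
  move=> s /andP[]; rewrite inE => sl ss0; apply: etrans (term s sl) _; apply: grid_sum0 => w.
  have sl' : s \in l by move: sl; rewrite inE (negPf ss0).
  have G0 x c : (forall v, v s = x -> a s v = c) ->
      G (upd w s x) (S :\ s)%SET = false.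
    move=> H; rewrite /G (cup_const (i := s) (c := c))// ?andbF// => u.
    move=> /(_ s); rewrite upd_id !inE eqxx addn0 => xu; apply: H.
    by apply/eqP; rewrite eqn_leq andbC.
  by rewrite (G0 _ _ (@am s)) (G0 _ _ (@a0 s)).
rewrite -[slice_sum _ _ _]/(grid_sum (s0 :: l) _ v) term ?mem_head//= eqxx.
under eq_grid_sum do rewrite /G Ssl am ?upd_id// a0 ?upd_id// addbF andTb.
by rewrite (grid_sum_upd _ (fun v => cup (map a l) v [set x in l]%SET))// IH.
Qed.

(** The total over the grid is odd, so some cell carries a nonzero product; by [cup_const] no
    labelling is constant on that cell. *)
Theorem discrete_poincare_miranda : exists v : vertex,
  (forall i, v i < m)%N /\
  forall i c, exists2 w, cube_vertex v [set: 'I_n]%SET w & a i w = c.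
Proof.
have /grid_sum_true[v cv [vm _]] :=
  @grid_sum_cup (enum 'I_n) (fun=> 0%N) (enum_uniq _).
exists v; split=> [i|i c]; first by apply: vm; rewrite mem_enum.
apply: contrapT => H; move: cv.
rewrite (@cup_const _ a _ i (~~ c)) ?mem_enum// => w vw.
case: (boolP (a i w == c)) => [/eqP ac|]; last by case: (a i w) c {H} => -[].
exfalso; apply: H; exists w => // j; have := vw j; rewrite !inE mem_enum.
by rewrite !inE.
Qed.

End discrete_poincare_miranda.

(** * Lebesgue's covering theorem *)

Lemma open_bigcap (T : topologicalType) (I : choiceType) (A : set I)
    (F : I -> set T) : finite_set A -> (forall i, A i -> open (F i)) ->
  open (\bigcap_(i in A) F i).
Proof.
move=> finA oF; rewrite -[X in open X]setCK setC_bigcap openC.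
by apply: closed_bigcup => // i Ai; rewrite closedC; exact: oF.
Qed.

(** Half of a radius that is good at [x] is good at all points near [x]; compactness, in its
    near-covering form, makes one radius serve all of [K]. *)
Lemma lebesgue_number (R : realType) (T : pseudoMetricType R) (I : Type)
    (K : set T) (W : I -> set T) :
  compact K -> (forall i, open (W i)) -> (forall x, K x -> exists i, W i x) ->
  exists2 d : R, 0 < d & forall x, K x -> exists i, ball x d `<=` W i.
Proof.
move=> /compact_near_coveringP cK oW KW.
have := cK _ (0^'+ : set_system R) (fun d x => exists i, ball x d `<=` W i) _ _.
case=> [x /KW[i Wix]|e /= e0 He].
  have /nbhs_ballP[e /= e0 eW] := open_nbhs_nbhs (conj (oW i) Wix).
  exists (ball x (e / 2), [set d : R | 0 < d < e / 2]) => /=.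
    split; first by apply: nbhsx_ballx; rewrite divr_gt0.
    near=> d => /=; apply/andP; split => //.
    by near: d; apply: nbhs_right_lt; rewrite divr_gt0.
  move=> [y d] /= [xy /andP[d0 de]]; exists i => z yz; apply: eW.
  rewrite (splitr e); apply: (ball_triangle xy).
  by apply: le_ball yz; exact: ltW.
exists (e / 2); first by rewrite divr_gt0.
apply: He; last by rewrite divr_gt0.
rewrite /= sub0r normrN gtr0_norm ?divr_gt0//.
by rewrite ltr_pdivrMr// ltr_pMr// ltr1n.
Unshelve. all: by end_near. Qed.

Section inradius.
Variables (R : realType) (T : pseudoMetricType R) (O : set T).

(** A substitute for the distance to the complement of [O]. The cap at 1 keeps it finite when [O] is
    the whole space, and the guard [0 < r] keeps 0 admissible when [x] is outside [O]. *)
Definition inradius (x : T) : R :=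
  sup [set r : R | 0 <= r <= 1 /\ (0 < r -> ball x r `<=` O)].

Lemma inradius_has_sup x :
  has_sup [set r : R | 0 <= r <= 1 /\ (0 < r -> ball x r `<=` O)].
Proof.
split; last by exists 1 => r [/andP[]].
by exists 0; rewrite /= lexx ler01; split => //; rewrite ltxx.
Qed.

Lemma inradius_ge0 x : 0 <= inradius x.
Proof.
apply: ub_le_sup; first by case: (inradius_has_sup x).
by rewrite /= lexx ler01; split => //; rewrite ltxx.
Qed.

Lemma inradius_gt0 x : open O -> O x -> 0 < inradius x.
Proof.
move=> oO Ox; have /nbhs_ballP[e /= e0 eO] := open_nbhs_nbhs (conj oO Ox).
have m0 : 0 < Num.min e 1 by rewrite lt_min e0 ltr01.
apply: (lt_le_trans m0); apply: ub_le_sup; first by case: (inradius_has_sup x).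
rewrite /= (ltW m0) ge_min lexx orbT; split => // _ y xy.
by apply: eO; apply: le_ball xy; rewrite ge_min lexx.
Qed.

Lemma inradius_gt0_in x : 0 < inradius x -> O x.
Proof.
apply: contraPP => nOx; apply/negP; rewrite -leNgt.
apply: ge_sup; first by case: (inradius_has_sup x).
by move=> r [_ rO]; rewrite leNgt; apply/negP => r0; exact/nOx/(rO r0)/ballxx.
Qed.

(** An admissible radius at [x], shrunk by [e], is admissible at [y]. *)
Lemma inradius_lip x y e : 0 <= e -> ball x e y -> inradius x <= inradius y + e.
Proof.
move=> e0 xy; apply: ge_sup; first by case: (inradius_has_sup x).
move=> r [/andP[r0 r1] rO]; rewrite -lerBlDr.
case: (leP r e) => [re|er]; first by rewrite (le_trans _ (inradius_ge0 y))// subr_le0.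
apply: ub_le_sup; first by case: (inradius_has_sup y).
split=> [|_ z yz]; first by rewrite subr_ge0 (ltW er) (le_trans _ r1)// gerBl.
apply: rO; first exact: le_lt_trans er.
by have := ball_triangle xy yz; rewrite addrC subrK.
Qed.

End inradius.

Lemma inradius_lt_open (R : realType) (T : pseudoMetricType R) (O P : set T) :
  open [set x | inradius O x < inradius P x].
Proof.
rewrite openE => x /= xOP; apply/nbhs_ballP.
(* Each of the two radii changes by at most a third of the gap, so the gap stays positive. *)
exists ((inradius P x - inradius O x) / 3) => /=.
  by rewrite divr_gt0// subr_gt0.
have e0 : 0 <= (inradius P x - inradius O x) / 3.
  by rewrite divr_ge0// subr_ge0 ltW.
move=> y xy /=; have := inradius_lip P e0 xy.
have := inradius_lip O e0 (ball_sym xy).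
lra.
Qed.

Definition unit_cube {R : realType} (n : nat) : set 'rV[R]_n :=
  [set x | forall i, 0 <= x ord0 i <= 1].
Arguments unit_cube {R} n _.

Lemma unit_cube_compact (R : realType) n : compact (@unit_cube R n).
Proof.
rewrite (_ : unit_cube n = [set x | forall i, `[0, 1]%classic (x ord0 i)]).
  by apply: (@rV_compact R n (fun=> `[0, 1]%classic)) => _; exact: segment_compact.
by apply/seteqP; split=> x Hx i; have := Hx i; rewrite /= in_itv.
Qed.

(* For [S] of fixed size the sets [W S] below are pairwise disjoint, so a cover
   of order [n] is turned into [n] disjoint families; the label [a i] records
   whether the member of the [i]-th family around a point reaches the face
   [x_i = 0]. *)
Theorem lebesgue_covering (R : realType) n k (O : 'I_k -> set 'rV[R]_n) :
  (forall j, open (O j)) -> unit_cube n `<=` \bigcup_j O j ->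
  (forall x, unit_cube n x -> (\sum_(j < k) (`[< O j x >] : nat) <= n)%N) ->
  exists j i x y, [/\ unit_cube n x, unit_cube n y, O j x, O j y &
    x ord0 i = 0 /\ y ord0 i = 1].
Proof.
move=> oO cO ordO; apply: contrapT => noface.
pose phi j := inradius (O j).
pose W (S : {set 'I_k}) : set 'rV[R]_n := (\bigcap_(j in [set` S]) O j) `&`
  \bigcap_(p in [set p : 'I_k * 'I_k | p.1 \in S /\ p.2 \notin S])
    [set x | phi p.2 x < phi p.1 x].
have W_open S : open (W S).
  apply: openI; apply: open_bigcap; try exact: finite_finset.
    by move=> j _; exact: oO.
  by move=> p _; exact: inradius_lt_open.
have W_disj (S S' : {set 'I_k}) x : #|S| = #|S'| -> W S x -> W S' x -> S = S'.
  move=> SS' [_ WS] [_ WS']; apply/eqP; rewrite eqEcard SS' leqnn andbT.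
  (* Distinct sets of equal size each have an element that the other lacks; the two resulting strict
     inequalities conflict. *)
  apply/fintype.subsetP => j jS; apply: contraT => jS'.
  have /fintype.subsetPn[l lS' lS] : ~~ (S' \subset S)%SET.
    apply/negP => sS; have /eqP SE : S' == S by rewrite eqEcard sS SS' leqnn.
    by rewrite SE jS in jS'.
  have := lt_trans (WS (j, l) (conj jS lS)) (WS' (l, j) (conj lS' jS')).
  by rewrite /= ltxx.
have W_cover x : unit_cube n x ->
    exists S : {S : {set 'I_k} | (0 < #|S| <= n)%N}, W (sval S) x.
  move=> cx; have [j0 _ Oj0] := cO x cx.
  case: (@Order.TotalTheory.arg_maxP _ _ _ j0 xpredT (phi^~ x)) => // jm _ jmax.
  have jm0 : 0 < phi jm x by apply: lt_le_trans (inradius_gt0 (oO j0) Oj0) (jmax j0 isT).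
  (* The indices that maximize [phi] at [x]. Their maximum is positive, so each [O j] contains [x],
     and the bound on the order limits their number to [n]. *)
  pose S := [set j | phi j x == phi jm x]%SET.
  have SO j : j \in S -> O j x.
    by rewrite inE => /eqP jjm; apply: inradius_gt0_in; rewrite -/(phi j) jjm.
  have Sn : (0 < #|S| <= n)%N.
    apply/andP; split; first by apply/card_gt0P; exists jm; rewrite inE.
    apply: leq_trans (ordO x cx); rewrite -sum1_card big_mkcond /=.
    by apply: leq_sum => j _; case: ifP => // /SO/asboolP ->.
  exists (exist _ S Sn); split=> [j /=|[j l] /= []]; first exact: SO.
  rewrite !inE => /eqP -> lm; rewrite lt_neqAle lm /=; exact: (jmax l isT).
have [d d0 dW] := lebesgue_number (@unit_cube_compact R n) (fun S => W_open _) W_cover.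
(* The mesh 1/m is below the Lebesgue number, so all vertices of a grid cube fall into one [W S]. *)
pose m := (Num.truncn d^-1).+1.
have m0 : 0 < m%:R :> R by rewrite ltr0n.
have md : m%:R^-1 < d by rewrite invf_plt ?posrE// truncnS_gt.
pose pt (w : 'I_n -> nat) : 'rV[R]_n := \row_i ((w i)%:R / m%:R).
(* Direction [i] is paired with the sets of size [i.+1], so the [n] directions account for the sizes
   1 to [n]. *)
pose reach (i : 'I_n) w (S : {set 'I_k}) := [/\ #|S| = i.+1, unit_cube n (pt w), W S (pt w) &
  exists y, [/\ unit_cube n y, W S y & y ord0 i = 0]].
pose a (i : 'I_n) w := ~~ `[< w i = 0%N \/ exists S, reach i w S >].
have a0 i w : w i = 0%N -> a i w = false.
  by move=> wi; apply/negbTE; rewrite negbK; apply/asboolP; left.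
(* On this face a reaching [S] would make some [O j] meet both faces of direction [i], which
   [noface] excludes. *)
have am i w : w i = m -> a i w = true.
  move=> wi; apply/negP => /asboolP[|[S [Si cw WSw [y [cy WSy yi]]]]].
    by rewrite wi.
  have /card_gt0P[j jS] : (0 < #|S|)%N by rewrite Si.
  apply: noface; exists j, i, y, (pt w).
  split=> //; [by case: WSy => + _; apply|by case: WSw => + _; apply|split=> //].
  by rewrite mxE wi divff// gt_eqF.
have [v [vm va]] := discrete_poincare_miranda a0 am.
have pt_cube w : (forall i, w i <= m)%N -> unit_cube n (pt w).
  move=> wm i; rewrite mxE divr_ge0//= ler_pdivrMr// mul1r ler_nat; exact: wm.
have [[S /= Sn] dS] := dW _ (pt_cube v (fun i => ltnW (vm i))).
have near_v w : cube_vertex v [set: 'I_n]%SET w -> unit_cube n (pt w) /\ W S (pt w).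
  move=> vw; split.
    apply: pt_cube => i; have /andP[_] := vw i; rewrite inE addn1.
    by move=> /leq_trans; apply; exact: vm.
  apply: dS; split=> // i j; rewrite !mxE /ball /= -mulrBl normrM.
  rewrite (@gtr0_norm _ m%:R^-1) ?invr_gt0// (le_lt_trans _ md)//.
  rewrite ler_piMl// ?invr_ge0 ?ler0n// distrC.
  have /andP[vwj] := vw j; rewrite inE addn1 => wvj.
  by rewrite -natrB// normr_nat (ler_nat _ _ 1) leq_subLR addn1.
have [i Si] : exists i : 'I_n, #|S| = i.+1.
  have iP : (#|S|.-1 < n)%N by case: #|S| Sn.
  by exists (Ordinal iP) => /=; case: #|S| Sn.
have [w1 vw1 aw1] := va i true; have [w0 vw0 aw0] := va i false.
have [cw1 Ww1] := near_v _ vw1; have [cw0 Ww0] := near_v _ vw0.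
(* The false label at [w0] provides a point of [W S] on the face x_i = 0: either [pt w0] itself, or
   a point of [W S'] with [S' = S] by disjointness. The same point would make the label at [w1]
   false. *)
suff : reach i w1 S.
  by move=> rw1; move/negP: aw1; apply; apply/asboolP; right; exists S.
split=> //; move: aw0 => /negbT; rewrite negbK => /asboolP[wi|[S' [S'i _ S'w0 +]]].
  by exists (pt w0); split=> //; rewrite mxE wi mul0r.
by rewrite (@W_disj S' S _ _ S'w0 Ww0)// S'i Si.
Qed.

(** * Absolutely convex sets and the finest locally convex topology *)

Section absolutely_convex.
Variables (R : realType) (E : lmodType R).
Implicit Types (V : set E).

Lemma convex_setE V : convex_set V <->
  forall x y (t : R), 0 <= t <= 1 -> V x -> V y -> V (t *: x + (1 - t) *: y).
Proof.
split=> [cV x y t /andP[t0 t1] Vx Vy|cV x y l].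
  by apply/set_mem; apply: (cV x y (Itv01 t0 t1)); exact/mem_set.
by move=> /set_mem Vx /set_mem Vy; apply/mem_set/cV; rewrite // ge0 le1.
Qed.

(** The sum is given as a multiple of a point of [V], without dividing by the total weight, so that
    total weight zero is allowed. *)
Lemma absconv_sum V (I : Type) (s : seq I) (c : I -> R) (x : I -> E) :
  convex_set V -> balanced_set V -> V 0 -> (forall i, V (x i)) ->
  exists2 v, V v & \sum_(i <- s) c i *: x i = (\sum_(i <- s) `|c i|) *: v.
Proof.
move=> /convex_setE cV bV V0 Vx; elim: s => [|i s [v Vv IH]].
  by exists 0 => //; rewrite !big_nil scaler0.
rewrite !big_cons IH; set r := \sum_(_ <- _) _.
have r0 : 0 <= r by rewrite sumr_ge0.
have [z|nz] := eqVneq (`|c i| + r) 0.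
  move/eqP: (z); rewrite paddr_eq0// normr_eq0 => /andP[/eqP ci /eqP r_0].
  by exists 0 => //; rewrite ci r_0 normr0 addr0 !scale0r addr0.
have z0 : 0 < `|c i| + r by rewrite lt_neqAle eq_sym nz addr_ge0.
exists ((`|c i| / (`|c i| + r)) *: (Num.sg (c i) *: x i) +
    (1 - `|c i| / (`|c i| + r)) *: v).
  apply: cV => //.
    by rewrite divr_ge0//= ?ler_pdivrMr ?mul1r ?lerDl// ltW.
  by apply: bV => //; rewrite normr_sg; case: (_ != _).
rewrite scalerDr !scalerA; congr (_ *: _ + _ *: _).
  by rewrite mulrCA divff// mulr1 mulrC -numEsg.
by rewrite mulrBr mulr1 mulrCA divff// mulr1 addrC addKr.
Qed.

Lemma absconv_sum_le V (I : finType) (c : I -> R) (x : I -> E) :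
  convex_set V -> balanced_set V -> V 0 -> (forall i, V (x i)) ->
  \sum_i `|c i| <= 1 -> V (\sum_i c i *: x i).
Proof.
move=> cV bV V0 Vx c1; have [v Vv ->] := absconv_sum (index_enum I) c cV bV V0 Vx.
by apply: bV => //; rewrite ger0_norm// sumr_ge0.
Qed.

Lemma absconv_scale V (a b : R) x : balanced_set V -> `|a| <= b ->
  V x -> exists2 v, V v & a *: x = b *: v.
Proof.
move=> bV ab Vx; have [b0|b0] := eqVneq b 0.
  by exists x => //; move: ab; rewrite b0 normr_le0 => /eqP ->.
exists ((a / b) *: x); last by rewrite scalerA mulrC divfK.
apply: bV => //; rewrite normrM normfV ler_pdivrMr ?mul1r ?normr_gt0//.
exact: le_trans (ler_norm b).
Qed.

(** The sum is the midpoint of [2 *: x] and [2 *: y]. *)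
Lemma absconv_halves V x y : convex_set V ->
  V (2 *: x) -> V (2 *: y) -> V (x + y).
Proof.
move=> /convex_setE cV Vx Vy; have := cV _ _ 2^-1 _ Vx Vy.
rewrite !scalerA mulVf// (_ : (1 - 2^-1) * 2 = 1); last by field.
by rewrite !scale1r; apply; rewrite invr_ge0 ler0n invf_le1// ler1n.
Qed.

Lemma absorbing_set0 V : absorbing_set V -> V 0.
Proof.
by move=> /(_ 0)[r r0] /(_ 0); rewrite scale0r normr0; apply; exact: ltW.
Qed.

End absolutely_convex.

(** * Neighborhoods of zero in a locally convex space *)

Section tvs_neighborhoods.
Variables (R : realType) (E : tvsType R).
Implicit Types (U : set E).

Lemma nbhs0_absorbing U : nbhs 0 U -> absorbing_set U.
Proof.
move=> U0 x; have := @scale_continuous R E (0, x) U; rewrite /= scale0r.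
move=> /(_ U0) [[A B] /= [/nbhs_ballP[r /= r0 rA] xB] ABU].
exists (r / 2); first by rewrite divr_gt0.
move=> t tr; apply: (ABU (t, x)); split => /=; last exact: nbhs_singleton.
apply: rA; rewrite /ball /= sub0r normrN (le_lt_trans tr)//.
by rewrite ltr_pdivrMr// ltr_pMr// ltr1n.
Qed.

(** [V] is the balanced core of a convex neighborhood [W]. Convexity of [W] and [W 0] put the
    intersection of [W] and its negative inside the core, which is therefore a neighborhood. *)
Lemma nbhs0_absconv U : nbhs 0 U ->
  exists V, [/\ nbhs 0 V, convex_set V, balanced_set V & V `<=` U].
Proof.
move=> U0; have [B cB [oB /(_ 0 U U0)]] := @locally_convex R E.
move=> [W /= [BW W0] WU]; have /convex_setE cW := cB W (mem_set BW).
exists [set x | forall t : R, `|t| <= 1 -> W (t *: x)]; split.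
- have nW : nbhs 0 W by apply: open_nbhs_nbhs; split=> //; exact: oB.
  apply: filterS (filterI nW (nbhs0N nW)) => x [Wx [y Wy yx]] t t1.
  have [t0|t0] := leP 0 t.
    have := cW x 0 t; rewrite scaler0 addr0; apply => //.
    by rewrite t0 (le_trans (ler_norm _)).
  have := cW y 0 (- t); rewrite scaler0 addr0 -yx scalerN scaleNr; apply => //.
  by rewrite oppr_ge0 (ltW t0) (le_trans _ t1)// ler0_norm// ltW.
- apply/convex_setE => x y t t01 Wx Wy r r1.
  by rewrite scalerDr !scalerA ![r * _]mulrC -!scalerA; apply: cW => //; [exact: Wx|exact: Wy].
- by move=> t x t1 Wx r r1; rewrite scalerA; apply: Wx; rewrite normrM mulr_ile1.
- by move=> x /(_ 1); rewrite normr1 scale1r => /(_ (lexx _))/WU.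
Qed.

Lemma tvs_boundedS (A B : set E) : A `<=` B -> tvs_bounded B -> tvs_bounded A.
Proof. by move=> AB bB U /bB[n Bn]; exists n; exact: subset_trans Bn. Qed.

End tvs_neighborhoods.

(** An alias of the carrier, so that it can bear a second topology beside the one it may already
    have. *)
Definition finest {R : realType} (E : lmodType R) : Type := E.

Section finest_topology.
Variables (R : realType) (E : lmodType R).
Local Notation F := (finest E).

HB.instance Definition _ := GRing.Lmodule.on F.

Definition finest_nbhs (x : F) : set_system F := fun A =>
  exists U : set F, [/\ convex_set U, balanced_set U, absorbing_set U &
    forall u, U u -> A (x + u)].

HB.instance Definition _ := hasNbhs.Build F finest_nbhs.

Lemma absconvI (U V : set F) :
  convex_set U /\ balanced_set U /\ absorbing_set U ->
  convex_set V /\ balanced_set V /\ absorbing_set V ->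
  convex_set (U `&` V) /\ balanced_set (U `&` V) /\ absorbing_set (U `&` V).
Proof.
move=> [/convex_setE cU [bU aU]] [/convex_setE cV [bV aV]]; split; [|split].
- by apply/convex_setE => x y t t1 [Ux Vx] [Uy Vy]; split; [exact: cU|exact: cV].
- by move=> t x t1 [Ux Vx]; split; [exact: bU|exact: bV].
- move=> x; have [r r0 rU] := aU x; have [s s0 sV] := aV x.
  exists (Num.min r s); first by rewrite lt_min r0.
  by move=> t; rewrite le_min => /andP[tr ts]; split; [exact: rU|exact: sV].
Qed.

Lemma absconv_preZ (U : set F) (a : R) :
  convex_set U /\ balanced_set U /\ absorbing_set U ->
  let aU := [set x : F | U (a *: x)] in
  convex_set aU /\ balanced_set aU /\ absorbing_set aU.
Proof.
move=> [/convex_setE cU [bU aU]]; split; [|split].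
- apply/convex_setE => x y t t1 Ux Uy /=.
  by rewrite scalerDr !scalerA ![a * _]mulrC -!scalerA; exact: cU.
- by move=> t x t1 Ux /=; rewrite scalerA mulrC -scalerA; exact: bU.
- move=> x; have [r r0 rU] := aU (a *: x); exists r => // t tr /=.
  by rewrite scalerA mulrC -scalerA; exact: rU.
Qed.

Fact finest_nbhs_filter (p : F) : ProperFilter (nbhs p).
Proof.
split; first by move=> [U [_ _ /absorbing_set0 U0]] /(_ _ U0).
split.
- exists setT; split=> //; last by move=> x; exists 1.
- move=> P Q [U [cU bU aU UP]] [V [cV bV aV VQ]].
  have [cUV [bUV aUV]] := absconvI (conj cU (conj bU aU)) (conj cV (conj bV aV)).
  by exists (U `&` V); split=> // u [Uu Vu]; split; [exact: UP|exact: VQ].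
- by move=> P Q PQ [U [cU bU aU UP]]; exists U; split=> // u /UP/PQ.
Qed.

Fact finest_nbhs_singleton (p : F) (A : set F) : nbhs p A -> A p.
Proof. by move=> [U [_ _ /absorbing_set0 U0]] /(_ _ U0); rewrite addr0. Qed.

Fact finest_nbhs_nbhs (p : F) (A : set F) : nbhs p A -> nbhs p (nbhs^~ A).
Proof.
move=> [U [cU bU aU UA]].
have [cV [bV aV]] := absconv_preZ 2 (conj cU (conj bU aU)).
exists [set x | U (2 *: x)]; split=> // u Uu.
exists [set x | U (2 *: x)]; split=> // v Uv.
by rewrite -addrA; apply: UA; exact: absconv_halves.
Qed.

HB.instance Definition _ := Nbhs_isNbhsTopological.Build F
  finest_nbhs_filter finest_nbhs_singleton finest_nbhs_nbhs.

Fact finest_add_continuous : continuous (fun x : F * F => x.1 + x.2).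
Proof.
move=> [x y] A [U [cU bU aU UA]].
have [cV [bV aV]] := absconv_preZ 2 (conj cU (conj bU aU)).
have nV z : nbhs z [set z + v | v in [set v : F | U (2 *: v)]].
  by exists [set v : F | U (2 *: v)]; split=> // v Vv; exists v.
exists ([set x + v | v in [set v : F | U (2 *: v)]],
  [set y + v | v in [set v : F | U (2 *: v)]]) => //=.
move=> [_ _] /= [[u Uu <-] [v Uv <-]].
by rewrite addrACA; apply: UA; exact: absconv_halves.
Qed.

Fact finest_scale_continuous : continuous (fun z : R^o * F => z.1 *: z.2).
Proof.
move=> [r x] A [U [cU bU aU UA]].
have b0 : 0 < `|r| + 1 by rewrite ltr_wpDl.
(* The factor |r| + 1 bounds |s| for [s] within 1 of [r], and the 2 prepares for [absconv_halves];
   [d] plays the same part for the term (s - r) x. *)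
have [cV [bV aV]] := absconv_preZ (2 * (`|r| + 1)) (conj cU (conj bU aU)).
have [d d0 dU] := aU (2 *: x).
set V := [set v : F | U ((2 * (`|r| + 1)) *: v)].
exists (ball (r : R^o) (Num.min d 1), [set x + v | v in V]) => /=.
  split; first by apply: nbhsx_ballx; rewrite lt_min d0 ltr01.
  by exists V; split=> // v Vv; exists v.
move=> [s _] /= [+ [v Vv <-]]; rewrite /ball /= lt_min => /andP[rsd rs1].
rewrite (_ : s *: (x + v) = r *: x + ((s - r) *: x + s *: v)); last first.
  by rewrite scalerDr addrA scalerBl addrCA subrr addr0.
apply: UA; apply: absconv_halves => //.
  by rewrite scalerA mulrC -scalerA; apply: dU; rewrite distrC ltW.
have [w Uw ww] : exists2 w, U w & s *: ((2 * (`|r| + 1)) *: v) = (`|r| + 1) *: w.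
  apply: absconv_scale => //.
  rewrite -[s](subrK r) (le_trans (ler_normD _ _))// addrC lerD2l distrC.
  exact: ltW.
rewrite (_ : 2 *: (s *: v) = w)//; apply: (scalerI (lt0r_neq0 b0)).
by rewrite -ww !scalerA; congr (_ *: _); ring.
Qed.

Fact finest_locally_convex :
  exists2 B : set_system F, (forall b, b \in B -> convex_set b) & basis B.
Proof.
exists [set W | open W /\ convex_set W]; first by move=> W /set_mem[].
split; first by move=> W [].
move=> x A [U [cU bU aU UA]].
pose W := interior [set x + u | u in U].
have WU : W `<=` [set x + u | u in U] by exact: interior_subset.
exists W; last by move=> y /WU[u Uu <-]; exact: UA.
split; last by exists U; split=> // u Uu; exists u.
split; first exact: open_interior.
apply/convex_setE => y z t t01 [V [cV bV aV yV]] [V' [cV' bV' aV' zV']].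
(* The interior is convex because a common translation [u] of both endpoints translates their convex
   combination by [u]. *)
have [cI [bI aI]] := absconvI (conj cV (conj bV aV)) (conj cV' (conj bV' aV')).
exists (V `&` V'); split=> // u [Vu V'u].
have [v Uv vE] := yV u Vu; have [w Uw wE] := zV' u V'u.
exists (t *: v + (1 - t) *: w); first by move/convex_setE: cU; apply.
have tE (q : F) : t *: q + (1 - t) *: q = q by rewrite -scalerDl addrC subrK scale1r.
by rewrite -{1}(tE x) addrACA -!scalerDr vE wE !scalerDr addrACA tE.
Qed.

(* This factory only produces the uniform structure. *)
HB.instance Definition _ := PreTopologicalLmod_isTvs.Build R F
  finest_add_continuous finest_scale_continuous finest_locally_convex.

HB.instance Definition _ :=
  PreTopologicalNmodule_isTopologicalNmodule.Build F finest_add_continuous.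
HB.instance Definition _ :=
  TopologicalNmodule_isTopologicalLmodule.Build R F finest_scale_continuous.
HB.instance Definition _ := Uniform_isTvs.Build R F finest_locally_convex.

Lemma finest_free : free_lcs (F : tvsType R).
Proof.
by move=> U cU bU aU; exists U; split=> // u; rewrite add0r.
Qed.

End finest_topology.

(** * Bounded sets in finite-dimensional subspaces *)

Section linear_combinations.
Variables (R : realType) (E : lmodType R) (n : nat) (b : 'I_n -> E).
Implicit Types t : 'rV[R]_n.

Definition lincomb t : E := \sum_i t ord0 i *: b i.

Fact lincomb_is_linear : linear lincomb.
Proof.
move=> a t u; rewrite /lincomb scaler_sumr -big_split; apply: eq_bigr => i _.
by rewrite !mxE scalerDl scalerA.
Qed.
HB.instance Definition _ := GRing.isLinear.Build R 'rV[R]_n E _ lincomb lincomb_is_linear.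

Lemma lincomb_delta i : lincomb (delta_mx ord0 i) = b i.
Proof.
rewrite /lincomb (bigD1 i)//= big1 => [|j ji]; last by rewrite mxE (negPf ji) andbF scale0r.
by rewrite mxE !eqxx scale1r addr0.
Qed.

Lemma lincomb_inj (S : set E) : lin_indep S -> injective b ->
  (forall i, S (b i)) -> injective lincomb.
Proof.
move=> Sfree bI Sb; apply: raddf_inj => t t0; apply/rowP => i; rewrite mxE.
(* Coefficients in [lin_indep] are indexed by vectors, so [c] inverts [b], with value 0 off its
   range. *)
pose c x := if [pick i | b i == x] is Some i then t ord0 i else 0.
have cb j : c (b j) = t ord0 j.
  by rewrite /c; case: pickP => [k /eqP/bI ->//|/(_ j)]; rewrite eqxx.
have us : uniq [seq b j | j : 'I_n] by rewrite map_inj_uniq// enum_uniq.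
have sS x : x \in [seq b j | j : 'I_n] -> S x by move=> /fintype.imageP[j _ ->].
rewrite -[LHS]cb; apply: (Sfree _ c us sS); last exact: fintype.image_f.
rewrite big_map big_enum /= -[RHS]t0.
by apply: eq_bigr => j _; rewrite cb.
Qed.

End linear_combinations.

Section finite_span.
Variables (R : realType) (E : tvsType R).

Lemma tvs_continuousD (T : topologicalType) (f g : T -> E) :
  continuous f -> continuous g -> continuous (fun t => f t + g t).
Proof.
move=> cf cg t; apply: (@continuous_comp _ _ _ (fun t => (f t, g t))
  (fun x : E * E => x.1 + x.2)); last exact: add_continuous.
by apply: cvg_pair; [exact: cf|exact: cg].
Qed.

Lemma tvs_continuousZ (T : topologicalType) (f : T -> R^o) (x : E) :
  continuous f -> continuous (fun t => f t *: x).
Proof.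
move=> cf t; apply: (@continuous_comp _ _ _ (fun t => (f t, x))
  (fun x : R^o * E => x.1 *: x.2)); last exact: scale_continuous.
have cx : continuous (fun=> x : E) := @cst_continuous T E x.
by apply: (cvg_pair (cf t) (cx t)).
Qed.

Lemma lincomb_continuous n (b : 'I_n -> E) : continuous (lincomb b).
Proof.
rewrite /lincomb; elim: (index_enum _) => [|i s IH].
  by under eq_fun do rewrite big_nil; exact: cst_continuous.
under eq_fun do rewrite big_cons.
apply: tvs_continuousD IH; apply: tvs_continuousZ; exact: coord_continuous.
Qed.

(** The image of the unit sphere is compact, hence closed, and misses 0 by injectivity. A balanced
    neighborhood of zero that avoids it bounds the coordinates of whatever it absorbs. *)
Lemma lincomb_bounded_coord n (b : 'I_n -> E) (B : set E) :
  hausdorff_space E -> injective (lincomb b) -> tvs_bounded B ->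
  exists M : R, forall t, B (lincomb b t) -> `|t| <= M.
Proof.
move=> hE bI bB; pose S := [set t : 'rV[R]_n | `|t| = 1].
have cS : compact (lincomb b @` S).
  apply: continuous_compact; first exact/continuous_subspaceT/lincomb_continuous.
  apply: bounded_closed_compact.
    by exists 1; split=> // r r1 t /= ->; exact: ltW.
  have -> : S = (fun t : 'rV[R]_n => `|t|) @^-1` [set 1] by [].
  by apply: preimage_closed; [move=> t _; exact: norm_continuous|exact: closed_eq].
have nS : nbhs 0 (~` (lincomb b @` S)).
  apply: open_nbhs_nbhs; split; first by rewrite openC; exact: compact_closed.
  move=> [t /= t1]; rewrite -(linear0 (lincomb b)) => /bI t0.
  by move: t1; rewrite /S /= t0 normr0 => /esym/eqP; rewrite oner_eq0.
have [V [V0 _ bV VS]] := nbhs0_absconv nS.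
have [k Bk] := bB V V0; exists k%:R => t /Bk[v Vv vt].
rewrite leNgt; apply/negP => kt; have t0 : 0 < `|t| by exact: le_lt_trans kt.
apply: (VS (lincomb b (`|t|^-1 *: t))).
  rewrite linearZ /= -vt scalerA; apply: bV => //.
  by rewrite normrM normfV normr_id ger0_norm// mulrC ler_pdivrMr// mul1r ltW.
exists (`|t|^-1 *: t) => //=.
by rewrite /S /= normrZ normfV normr_id mulVf// gt_eqF.
Qed.

Lemma compact_tvs_bounded (K : set E) : compact K -> tvs_bounded K.
Proof.
move=> /compact_near_coveringP cK U /nbhs0_absconv[V [V0 cV bV VU]].
have := cK nat \oo (fun n x => V (n%:R^-1 *: x)) _ _.
case=> [x Kx|N _ NK].
  have [r r0 rV] := nbhs0_absorbing V0 x.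
  (* Of the two halves of [x + v], the bound 2 on [n] handles [v] and the bound 2/r handles [x]. *)
  exists ([set x + v | v in V], [set n | (2%:R <= n%:R :> R) && (2 / r <= n%:R)]) => /=.
    split; first exact: nbhsT.
    near=> n => /=; apply/andP; split; near: n; exact: nbhs_infty_ger.
  move=> [_ n] /= [[v Vv <-] /andP[n2 nr]]; have n0 : 0 < n%:R :> R by exact: lt_le_trans n2.
  rewrite scalerDr; apply: absconv_halves => //; rewrite scalerA.
    by apply: rV; rewrite ger0_norm ?divr_ge0// ler_pdivrMr// mulrC -ler_pdivrMr.
  by apply: bV => //; rewrite ger0_norm ?divr_ge0// ler_pdivrMr// mul1r.
exists N.+1 => x Kx; exists (N.+1%:R^-1 *: x); last by rewrite scalerA divff// scale1r.
exact/VU/(NK N.+1 (leqnSn N)).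
Unshelve. all: by end_near. Qed.

(** Finitely many vectors of the union already lie in one member of the chain. *)
Lemma lin_indep_bigcup (F : set (set E)) : F `<=` @lin_indep R E ->
  total_on F subset -> lin_indep (\bigcup_(X in F) X).
Proof.
move=> Ffree totF s c us sF s0 x xs.
suff [X FX sX] : exists2 X, F X & forall y, y \in s -> X y.
  exact: (Ffree X FX s c us sX s0 x xs).
elim: s {us s0} sF x xs => // y s IH sF x _.
have [X FX Xy] := sF y (mem_head y s).
have sF' z : z \in s -> (\bigcup_(X in F) X) z.
  by move=> zs; apply: sF; rewrite inE zs orbT.
(* The one-element list is separate because the induction hypothesis needs a member of the list. *)
case: s IH sF sF' => [|z s] IH sF sF'.
  by exists X => // z; rewrite inE => /eqP ->.
have [Y FY sY] := IH sF' z (mem_head z s).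
have [XY|YX] := totF X Y FX FY.
  by exists Y => // u; rewrite inE => /orP[/eqP ->|/sY//]; exact: XY.
by exists X => // u; rewrite inE => /orP[/eqP ->//|/sY]; exact: YX.
Qed.

(** A relation with a nonzero coefficient at [x] would put [x] in the span. *)
Lemma lin_indep_cons (S : set E) n (b : 'I_n -> E) (x : E) :
  lin_indep S -> S `<=` range (lincomb b) -> ~ range (lincomb b) x ->
  lin_indep (x |` S).
Proof.
move=> Sfree Sb bx s c us sS s0.
have inS y : y \in s -> y != x -> S y by move=> /sS[->|//]; rewrite eqxx.
have sumS (r : seq E) : {in r, forall y, S y} ->
    range (lincomb b) (\sum_(y <- r) c y *: y).
  elim: r => [|y r IH] rS; first by rewrite big_nil; exists 0 => //; rewrite linear0.
  have [|t _ tE] := IH; first by move=> z zr; apply: rS; rewrite inE zr orbT.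
  have [u _ uE] := Sb y (rS y (mem_head _ _)).
  by rewrite big_cons; exists (c y *: u + t) => //; rewrite linearP /= uE tE.
have remS : {in rem x s, forall y, S y}.
  by move=> y; rewrite (mem_rem_uniq _ us) inE => /andP[yx ys]; exact: inS.
have cx : x \in s -> c x = 0.
  move=> xs; apply: contrapT => /eqP cx; apply: bx.
  move: s0; rewrite (big_rem x xs) /= => /eqP; rewrite addr_eq0 => /eqP cxx.
  have [t _ tE] := sumS _ remS; exists (- (c x)^-1 *: t) => //.
  rewrite linearZ /= tE -[\sum_(y <- _) _]opprK -cxx scalerN scaleNr opprK.
  by rewrite scalerA mulVf// scale1r.
have s0' : \sum_(y <- rem x s) c y *: y = 0.
  have [xs|xs] := boolP (x \in s); last by rewrite rem_id.
  by move: s0; rewrite (big_rem x xs) /= cx// scale0r add0r.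
move=> y ys; have [yx|yx] := eqVneq y x; first by rewrite yx in ys *; exact: cx.
apply: (Sfree (rem x s)) => //; first exact: rem_uniq.
by rewrite (mem_rem_uniq _ us) inE yx.
Qed.

Lemma bounded_finite_span (B : set E) :
  (forall B : set E, tvs_bounded B -> lin_indep B -> finite_set B) ->
  tvs_bounded B -> exists n (b : 'I_n -> E),
    injective (lincomb b) /\ B `<=` range (lincomb b).
Proof.
move=> c2 bB.
have [F FB totF|A [[AB Afree] maxA]] :=
    @Zorn_bigcup E [set S | S `<=` B /\ lin_indep S].
  split; first by move=> x [X /FB[XB _]]; exact: XB.
  by apply: lin_indep_bigcup => // X /FB[].
have /finite_seqP[s0 As0] := c2 A (tvs_boundedS AB bB) Afree.
pose s := undup s0; pose b (i : 'I_(size s)) := tnth (in_tuple s) i.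
have bA i : A (b i) by rewrite As0 /= -mem_undup mem_tnth.
have bI : injective b by apply/tuple_uniqP; exact: undup_uniq.
exists (size s), b; split; first exact: lincomb_inj bA.
move=> x Bx; apply: contrapT => nx.
have Ab : A `<=` range (lincomb b).
  move=> y; rewrite As0 /= -mem_undup => /(tnthP (in_tuple s))[i ->].
  by exists (delta_mx ord0 i) => //; rewrite lincomb_delta.
apply: (maxA (x |` A)); last first.
  by split; [move=> y [->//|]; exact: AB|exact: lin_indep_cons nx].
by split; [move=> y; right|move=> /(_ x (or_introl erefl))/Ab].
Qed.

End finite_span.

(** * Compact sets and covering dimension *)

Lemma rV_coord_le_norm (R : realType) n (t : 'rV[R]_n) i : `|t ord0 i| <= `|t|.
Proof.
rewrite [leRHS]/Num.norm /= mx_normrE.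
by apply/bigmax_geP; right => /=; exists (ord0, i).
Qed.

Section topological_dimension.
Variables (R : realType) (E : tvsType R).
Hypothesis hE : hausdorff_space E.

(* The coordinates are covered by the balls of radius [d / 2] around the grid of
   step [d / 2]; grid points of equal parity are at distance at least [d], so
   each point lies in at most [2 ^ n] of these balls. *)
Lemma compact_finite_span_dim n (b : 'I_n -> E) (K : set E) :
  injective (lincomb b) -> K `<=` range (lincomb b) -> compact K ->
  finite_top_dim K.
Proof.
set h := lincomb b => hI Kh cK; have hc : continuous h by exact: lincomb_continuous.
pose K' := h @^-1` K.
have [M0 M0K] := lincomb_bounded_coord hE hI (compact_tvs_bounded cK).
pose M := Num.max M0 0; have M_ge0 : 0 <= M by rewrite le_max lexx orbT.
have MK t : K' t -> `|t| <= M by move=> /M0K tM; rewrite le_max tM.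
have cK' : compact K'.
  apply: bounded_closed_compact.
    by exists M; split; [exact: num_real|move=> r Mr t /MK /le_trans; apply; exact: ltW].
  by apply: preimage_closed; [move=> t _; exact: hc|exact: compact_closed].
exists (2 ^ n)%N => m U oU KU.
(* A nonempty [K] supplies an index [i0] to which balls that miss [K] can be assigned. *)
have [K0|/set0P[x0 Kx0]] := eqVneq K set0.
  exists 0%N, (fun=> setT); split;
    [by move=> _; exact: openT|by rewrite K0|by case|by move=> x _; rewrite big_ord0].
have [i0 _ Ui0] := KU x0 Kx0.
have [d d0 dK] : exists2 d : R, 0 < d & forall t, K' t -> exists i, ball t d `<=` h @^-1` (U i).
  apply: lebesgue_number cK' _ _ => [i|t Kt]; first by apply: open_comp => // t _; exact: hc.
  by have [i _ Ui] := KU _ Kt; exists i.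
pose e := d / 2; have e0 : 0 < e by rewrite divr_gt0.
(* Indices from 0 to 2p, shifted by [p], give a grid of step [e] from -pe to pe, which covers
   [-M, M]. *)
pose p := (Num.truncn (M / e)).+1.
have pM : M / e < p%:R by exact: truncnS_gt.
pose J := {ffun 'I_n -> 'I_(p + p).+1}.
pose ctr (v : J) : 'rV[R]_n := \row_i (((v i : nat)%:R - p%:R) * e).
(* The image of a ball need not be open in [E]; the complement of a compact image is open and has
   the same trace on [K]. *)
pose V (v : J) := ~` (h @` (K' `&` ~` ball (ctr v) e)).
have VK v t : K' t -> V v (h t) <-> ball (ctr v) e t.
  move=> Kt; split=> [nt|vt [s [_ /[swap] /hI ->]] //].
  by apply: contrapT => vt; apply: nt; exists t.
have oV v : open (V v).
  rewrite openC; apply: compact_closed => //.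
  apply: continuous_compact; first exact: continuous_subspaceT.
  by apply: compact_closedI => //; rewrite closedC; exact: ball_open.
have KE x : K x -> exists2 t, K' t & h t = x.
  by move=> Kx; have [t _ tx] := Kh x Kx; exists t => //; rewrite /K' /= tx.
exists #|J|, (fun j => V (enum_val j)); split=> //.
- move=> x /KE[t Kt <-].
  have coord i : `|t ord0 i| <= M.
    by apply: le_trans (MK t Kt); exact: rV_coord_le_norm.
  have te i : 0 <= t ord0 i / e + p%:R <= (p + p)%:R.
    have := coord i; rewrite ler_norml => /andP[t1 t2].
    rewrite natrD lerD2r -lerBlDr sub0r lerNl -mulNr.
    apply/andP; split; apply: le_trans (ltW pM); rewrite ler_pM2r ?invr_gt0//.
    by rewrite lerNl.
  have vP i : (Num.truncn (t ord0 i / e + p%:R) < (p + p).+1)%N.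
    have /andP[te0 te1] := te i; rewrite ltnS -(ler_nat R).
    by have /andP[+ _] := truncn_itv te0; move=> /le_trans; exact.
  (* Truncation selects the grid point at or just below each coordinate, at distance less than
     [e]. *)
  pose v : J := [ffun i => Ordinal (vP i)].
  exists (enum_rank v) => //; rewrite enum_rankK; apply/VK => //.
  split=> // a i; rewrite (ord1 a) !mxE ffunE /= /ball /=.
  have /andP[te0 _] := te i; have := truncn_itv te0.
  set w := Num.truncn _ => /andP[w1 w2].
  rewrite (_ : (w%:R - p%:R) * e - t ord0 i = (w%:R - (t ord0 i / e + p%:R)) * e); last first.
    by field; rewrite gt_eqF.
  rewrite normrM (gtr0_norm e0) -[ltRHS]mul1r ltr_pM2r// ltr_norml.
  by move: w2; rewrite -natr1 => w2; apply/andP; split; lra.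
- move=> j; set v := enum_val j.
  have [[s [Ks vs]]|nv] := pselect (exists s, K' s /\ ball (ctr v) e s); last first.
    exists i0 => x [Vx /KE[t Kt tx]]; exfalso; apply: nv; exists t; split=> //.
    by apply/VK => //; rewrite tx.
  have [i di] := dK s Ks; exists i => x [Vx /KE[t Kt tx]]; rewrite -tx; apply: di.
  move: Vx; rewrite -tx => /(VK _ _ Kt) vt; rewrite (splitr d).
  exact: ball_triangle (ball_sym vs) vt.
- move=> x /KE[t Kt <-]; apply: (@leq_trans (2 ^ n)%N) => //.
  pose A := [set j : 'I_#|J| | `[< V (enum_val j) (h t) >]]%SET.
  rewrite (_ : (\sum_(j < _) _)%N = #|A|); last first.
    rewrite -sum1_card [RHS]big_mkcond /=; apply: eq_bigr => j _.
    by rewrite inE; case: asboolP.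
  pose parity (j : 'I_#|J|) := [ffun i => odd (enum_val j i)].
  have pI : {in A &, injective parity}.
    move=> j j'; rewrite !inE => /asboolP/asboolP Vj /asboolP/asboolP Vj' /ffunP jj'.
    have {Vj} [_ Vj] : ball (ctr (enum_val j)) e t by exact/VK.
    have {Vj'} [_ Vj'] : ball (ctr (enum_val j')) e t by exact/VK.
    apply: enum_val_inj; apply/ffunP => i; apply/val_inj => /=.
    have := jj' i; rewrite !ffunE => par.
    have := Vj ord0 i; have := Vj' ord0 i; rewrite !mxE /ball /=.
    move: (enum_val j i) (enum_val j' i) par => x1 x2 par.
    rewrite !ltr_norml => /andP[lo2 hi2] /andP[lo1 hi1].
    (* Indices of grid points within [e] of the same coordinate differ by at most 1, so equal parity
       makes them equal. *)
    have lt2 (a c : nat) : (a%:R - p%:R) * e - t ord0 i < e ->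
        - e < (c%:R - p%:R) * e - t ord0 i -> (a < c.+2)%N.
      move=> a1 c1; rewrite -(ltr_nat R) -(ltr_pM2r e0) -addn2 natrD.
      by move: a1 c1; rewrite !mulrBl mulrDl; lra.
    by have := lt2 _ _ hi1 lo2; have := lt2 _ _ hi2 lo1; lia.
  have -> : (2 ^ n)%N = #|{ffun 'I_n -> bool}| by rewrite card_ffun card_bool card_ord.
  by rewrite -(card_in_imset pI) max_card.
Qed.

Lemma tvs_bounded_scale (B V : set E) : tvs_bounded B -> balanced_set V -> nbhs 0 V ->
  exists k : nat, forall n x, (k <= n)%N -> B x -> V (n.+1%:R^-1 *: x).
Proof.
move=> bB bV V0; have [k Bk] := bB V V0; exists k => n x kn /Bk[v Vv <-].
rewrite scalerA; apply: bV => //; rewrite ger0_norm ?mulr_ge0 ?invr_ge0//.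
by rewrite mulrC ler_pdivrMr// mul1r ler_nat ltnW.
Qed.

(* The scaling makes the cubes shrink to 0, hence their union with 0 compact. *)
Definition small_cube (b : nat -> E) n : set E :=
  lincomb (fun i : 'I_n => (n.+1%:R^-1 * n.+1%:R^-1) *: b i) @` unit_cube n.

(** A filter that does not cluster at 0 lives off a neighborhood of 0, hence on finitely many cubes,
    whose union is compact. *)
Lemma small_cubes_compact (b : nat -> E) : tvs_bounded (range b) ->
  compact ([set 0] `|` \bigcup_n small_cube b n).
Proof.
move=> bb F FF FK; apply: contrapT => nc.
have cQ n : compact (small_cube b n).
  apply: continuous_compact; last exact: unit_cube_compact.
  exact/continuous_subspaceT/lincomb_continuous.
have /existsNP[A /existsNP[U /not_implyP[FA /not_implyP[U0 AU]]]] : ~ cluster F 0.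
  by move=> c0; apply: nc; exists 0; split=> //; left.
have [V [V0 cV bV VU]] := nbhs0_absconv U0.
have [k Vk] := tvs_bounded_scale bb bV V0.
have QV n : (k <= n)%N -> small_cube b n `<=` V.
  move=> kn _ [t ct <-]; rewrite /lincomb.
  (* One factor of the scaling brings each [b i] into [V]; the other makes the [n] weights sum to at
     most 1. *)
  under eq_bigr do rewrite scalerA mulrA -scalerA.
  apply: absconv_sum_le => //; first exact: nbhs_singleton.
    by move=> i; apply: Vk => //; exists (i : nat).
  apply: (@le_trans _ _ (\sum_(i < n) n.+1%:R^-1)).
    apply: ler_sum => i _; have /andP[t0 t1] := ct i.
    by rewrite ger0_norm ?mulr_ge0 ?invr_ge0// ler_piMl ?invr_ge0.
  by rewrite sumr_const card_ord -[leLHS]mulr_natl ler_pdivrMr// mul1r ler_nat.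
have cQk : compact (\big[setU/set0]_(n < k) small_cube b n).
  by apply: bigsetU_compact => n _; exact: cQ.
have FQ : F (\big[setU/set0]_(n < k) small_cube b n).
  apply: filterS (filterI FA FK) => x [Ax Kx].
  have nVx : ~ V x by move=> /VU Ux; apply: AU; exists x.
  case: Kx => [x0|[n _ Qx]].
    by exfalso; apply: nVx; rewrite x0; exact: nbhs_singleton.
  rewrite -(bigcup_mkord k (small_cube b)); exists n => //.
  by rewrite /= ltnNge; apply/negP => kn; apply: nVx; exact: QV Qx.
have [x [Qx cx]] := cQk F FF FQ; apply: nc; exists x; split=> //; right.
by move: Qx; rewrite -(bigcup_mkord k (small_cube b)) => -[n _ Qx]; exists n.
Qed.

(** In every direction each member of the cover [U] misses one of the two opposite faces, so no
    refinement has a member meeting both; [lebesgue_covering] in dimension [N.+1] produces one if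
    the order is at most [N.+1]. *)
Lemma cube_covdim (K : set E) N (b : 'I_N.+1 -> E) :
  injective (lincomb b) -> lincomb b @` unit_cube N.+1 `<=` K -> ~ covdim_le K N.
Proof.
set n := N.+1 in b *; set h := lincomb b => hI hK dimK.
have hc : continuous h by exact: lincomb_continuous.
pose face (A : {set 'I_n}) i := unit_cube n `&`
  [set t | t ord0 i = (if i \in A then 0 else 1 : R)].
pose U (A : {set 'I_n}) := ~` \bigcup_i (h @` face A i).
have [|x Kx|k [V [oV KV VU ordV]]] := dimK #|{set 'I_n}| (fun j => U (enum_val j)).
- move=> j; rewrite openC; apply: closed_bigcup; first exact: finite_finset.
  move=> i _; apply: compact_closed => //; apply: continuous_compact.
    exact: continuous_subspaceT.
  rewrite /face; apply: compact_closedI; first exact: unit_cube_compact.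
  pose c : R := if i \in enum_val j then 0 else 1.
  rewrite [X in closed X](_ : _ = (fun t : 'rV[R]_n => t ord0 i) @^-1` [set c])//.
  by apply: preimage_closed; [move=> t _; exact: coord_continuous|exact: closed_eq].
- have [[t ct tx]|nx] := pselect ((h @` unit_cube n) x); last first.
    exists (enum_rank (finset.set0 : {set 'I_n})) => // -[i _ [s [cs _] sx]].
    by apply: nx; exists s.
  (* For this set, [t] is off the face x_i = 0 when [i] belongs to it, and has coordinate 0 rather
     than 1 when not. *)
  exists (enum_rank [set i | t ord0 i != 0]%SET) => //; rewrite enum_rankK.
  move=> [i _ [s [_ /= si]]]; rewrite -tx => /hI st; move: si; rewrite st inE.
  case: eqVneq => [-> /esym/eqP|ti /= ti0]; first by rewrite oner_eq0.
  by rewrite ti0 eqxx in ti.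
- have [|||j [i [x [y [cx cy Vx Vy [xi yi]]]]]] := @lebesgue_covering R n k (fun j => h @^-1` V j).
  + by move=> j; apply: open_comp; [move=> t _; exact: hc|exact: oV].
  + by move=> t ct; apply: KV; apply: hK; exists t.
  + by move=> t ct; apply: ordV; apply: hK; exists t.
  have [l Ul] := VU j; have hKt t : unit_cube n t -> K (h t) by move=> ct; apply: hK; exists t.
  have [iA|iA] := boolP (i \in enum_val l).
    by apply: (Ul (h x) (conj Vx (hKt x cx))); exists i => //; exists x; rewrite /face /= ?iA.
  apply: (Ul (h y) (conj Vy (hKt y cy))); exists i => //.
  by exists y; rewrite /face /= ?(negbTE iA).
Qed.

Lemma infinite_set_seq (T : Type) (B : set T) : infinite_set B ->
  exists b : nat -> T, injective b /\ forall i, B (b i).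
Proof.
move=> /infiniteP/card_leP[f]; pose nat_elt i : [set: nat] := SigSub (mem_set (I : setT i)).
exists (fun i => val (f (nat_elt i))); split=> [i j /val_inj|i]; last exact: set_valP.
by move=> /(@inj _ _ _ f _ _ (in_setT _) (in_setT _)) /(congr1 val).
Qed.

Lemma finite_top_dim_bounded :
  (forall K : set E, compact K -> finite_top_dim K) <->
  (forall B : set E, tvs_bounded B -> lin_indep B -> finite_set B).
Proof.
split=> [c1 B bB Bfree|c2 K cK]; last first.
  have [n [b [bI Kb]]] := bounded_finite_span c2 (compact_tvs_bounded cK).
  exact: compact_finite_span_dim bI Kb cK.
apply: contrapT => /infinite_set_seq[b [bI Bb]].
have bb : tvs_bounded (range b) by apply: tvs_boundedS bB => _ [i _ <-].
(* The cube of dimension [N.+1] refutes the alleged dimension [N]. *)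
have [N] := c1 _ (small_cubes_compact bb); apply: (@cube_covdim _ _ (fun i : 'I_N.+1 =>
  (N.+2%:R^-1 * N.+2%:R^-1) *: b i)); last first.
  by move=> x Qx; right; exists N.+1.
have cI : injective (lincomb (fun i : 'I_N.+1 => b i)).
  by apply: (lincomb_inj Bfree) => // i j /bI; exact: val_inj.
have c0 : N.+2%:R^-1 * N.+2%:R^-1 != 0 :> R by rewrite mulf_neq0 ?invr_eq0 ?pnatr_eq0.
have scaled t : lincomb (fun i : 'I_N.+1 => (N.+2%:R^-1 * N.+2%:R^-1) *: b i) t =
    (N.+2%:R^-1 * N.+2%:R^-1) *: lincomb (fun i : 'I_N.+1 => b i) t.
  by rewrite /lincomb scaler_sumr; apply: eq_bigr => i _; rewrite !scalerA mulrC.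
by move=> t u; rewrite !scaled => /(scalerI c0)/cI.
Qed.

End topological_dimension.

(** * Free spaces *)

Section linear_graph.
Variables (R : realType) (E : lmodType R).
Implicit Types (G : set (E * R)).

(** The graph of a linear functional on a subspace, kept as a relation so that Zorn's lemma applies
    to unions; the last clause is single-valuedness. *)
Definition linear_graph G : Prop := [/\ G (0, 0),
  forall (a : R) x y r s, G (x, r) -> G (y, s) -> G (a *: x + y, a * r + s) &
  forall r, G (0, r) -> r = 0].

Lemma linear_graph_extend G0 : linear_graph G0 ->
  exists G, [/\ linear_graph G, G0 `<=` G & forall x, exists r, G (x, r)].
Proof.
(* Requiring linearity of the union with [G0] makes the empty chain harmless. *)
move=> linG0; have [F FP totF|X [linX maxX]] :=
    @Zorn_bigcup (E * R)%type [set X | linear_graph (G0 `|` X)].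
  have [G00 G0lin G0fun] := linG0; split; first by left.
    move=> a x y r s.
    have one X p q : F X -> (G0 `|` X) p -> (G0 `|` X) q ->
        p = (x, r) -> q = (y, s) -> (G0 `|` \bigcup_(X in F) X) (a *: x + y, a * r + s).
      move=> FX + + pE qE; rewrite pE qE => Xp Xq.
      have [_ lin _] := FP X FX.
      by have [|Xpq] := lin a _ _ _ _ Xp Xq; [left|right; exists X].
    move=> [Gp|[X FX Xp]] [Gq|[Y FY Yq]]; first by left; exact: G0lin.
    - by apply: (one Y _ _ FY _ _ erefl erefl); [left|right].
    - by apply: (one X _ _ FX _ _ erefl erefl); [right|left].
    - have [XY|YX] := totF X Y FX FY.
        by apply: (one Y _ _ FY _ _ erefl erefl); right => //; exact: XY.
      by apply: (one X _ _ FX _ _ erefl erefl); right => //; exact: YX.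
  move=> r [|[X FX Xr]]; first exact: G0fun.
  by have [_ _] := FP X FX; apply; right.
set G := G0 `|` X in linX; exists G; split=> //; first by move=> p; left.
move=> x0; apply: contrapT => nx0; have [G00 Glin Gfun] := linX.
(* The functional is extended by the value 0 at [x0]. *)
pose X' : set (E * R) := [set p | exists a y, G (y, p.2) /\ p.1 = y + a *: x0].
have GX' : G `<=` X'.
  by move=> [y s] Gy; exists 0, y; rewrite scale0r addr0.
have XX' : X `<` X'.
  split; first by move=> p Xp; apply: GX'; right.
  have X'0 : X' (x0, 0) by exists 1, 0; rewrite scale1r add0r.
  by move=> X'X; apply: nx0; exists 0; right; exact: X'X.
apply: (maxX X' XX') => /=; rewrite setUidr; last by apply: subset_trans GX' => p; left.
split; first exact: GX'.
  move=> a x y r s [c [x' [Gx /= ->]]] [d [y' [Gy /= ->]]].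
  exists (a * c + d), (a *: x' + y'); split; first exact: Glin.
  by rewrite /= scalerDr scalerDl scalerA addrACA.
move=> r [a [y [Gy /= /esym/eqP]]]; rewrite addr_eq0 => /eqP ya.
have [a0|a0] := eqVneq a 0.
  by apply: Gfun; move: Gy; rewrite ya a0 scale0r oppr0.
exfalso; apply: nx0; exists (- a^-1 * r + 0).
have := Glin (- a^-1) _ _ _ _ Gy G00.
by rewrite ya scalerN scaleNr opprK scalerA mulVf// scale1r addr0.
Qed.

End linear_graph.

Lemma free_bounded_finite (R : realType) (F : tvsType R) (B : set F) :
  free_lcs F -> tvs_bounded B -> lin_indep B -> finite_set B.
Proof.
move=> freeF bB Bfree; apply: contrapT => /infinite_set_seq[b [bI Bb]].
(* The functional with value [i] at [b i]. Equality for all large [N] encodes finite support and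
   lets two combinations be added at the larger threshold. *)
pose G0 : set (F * R) := [set p | exists (c : nat -> R) N0, forall N, (N0 <= N)%N ->
  p.1 = \sum_(i < N) c i *: b i /\ p.2 = \sum_(i < N) c i * i%:R].
have [|G [[G00 Glin Gfun] G0G Gtot]] := @linear_graph_extend R F G0.
  split.
  - exists (fun=> 0), 0%N => N _ /=; split; first by rewrite big1// => i _; rewrite scale0r.
    by rewrite big1// => i _; rewrite mul0r.
  - move=> a x y r s [c [N1 cN]] [d [N2 dN]]; exists (fun i => a * c i + d i), (maxn N1 N2).
    move=> N; rewrite geq_max => /andP[/cN[/= -> ->] /dN[/= -> ->]].
    rewrite scaler_sumr mulr_sumr -!big_split /=; split; apply: eq_bigr => i _.
      by rewrite scalerA scalerDl.
    by rewrite mulrDl mulrA.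
  - move=> r [c [N cN]]; have [/= s0 ->] := cN N (leqnn N).
    have cI : injective (lincomb (fun i : 'I_N => b i)).
      by apply: (lincomb_inj Bfree) => // i j /bI; exact: val_inj.
    have /cI/rowP c0 : lincomb (fun i : 'I_N => b i) (\row_i c i) =
        lincomb (fun i : 'I_N => b i) 0.
      by rewrite linear0 s0; apply: eq_bigr => i _; rewrite mxE.
    by rewrite big1// => i _; have := c0 i; rewrite !mxE => ->; rewrite mul0r.
have GZ a x r : G (x, r) -> G (a *: x, a * r).
  by move=> Gx; have := Glin a _ _ _ _ Gx G00; rewrite !addr0.
pose U := [set x | exists2 r, G (x, r) & `|r| <= 1].
have nU : nbhs 0 U.
  apply: freeF.
  - apply/convex_setE => x y t /andP[t0 t1] [r Gx r1] [s Gy s1].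
    exists (t * r + (1 - t) * s); first by apply: Glin => //; exact: GZ.
    rewrite (le_trans (ler_normD _ _))// !normrM ger0_norm// (@ger0_norm _ (1 - t)) ?subr_ge0//.
    rewrite -[leRHS](subrK t) addrC lerD// -[leRHS]mulr1 ler_wpM2l// subr_ge0//.
  - move=> t x t1 [r Gx r1]; exists (t * r); first exact: GZ.
    by rewrite normrM mulr_ile1.
  - move=> x; have [r Gx] := Gtot x; exists (`|r| + 1)^-1; first by rewrite invr_gt0 ltr_wpDl.
    move=> t tr; exists (t * r); first exact: GZ.
    rewrite normrM (le_trans (ler_wpM2r _ tr))// mulrC ler_pdivrMr ?ltr_wpDl//.
    by rewrite mul1r lerDl.
(* If [k] times [U] contained [b k.+1], whose value is [k.+1], then [k.+1] would be at most [k]. *)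
have [k Bk] := bB U nU; have [u [r Gu r1] ub] := Bk (b k.+1) (Bb _).
have Gb : G (b k.+1, k.+1%:R).
  apply: G0G; exists (fun i => (i == k.+1)%:R), k.+2 => N kN /=.
  rewrite (bigD1 (Ordinal kN))//= [X in _ = _ + X](big1 _ _ _)//= => [|i]; last first.
    by rewrite -val_eqE /= => /negPf ->; rewrite scale0r.
  rewrite (bigD1 (Ordinal kN))//= [X in _ /\ _ = _ + X](big1 _ _ _)//= => [|i]; last first.
    by rewrite -val_eqE /= => /negPf ->; rewrite mul0r.
  by rewrite eqxx scale1r mul1r !addr0.
have /Gfun/eqP : G (0, - k%:R * r + k.+1%:R).
  by have := Glin (- k%:R) _ _ _ _ Gu Gb; rewrite -ub scaleNr addNr.
rewrite addrC mulNr subr_eq0 => /eqP kr.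
have : (k.+1%:R : R) <= k%:R.
  rewrite kr -[leRHS]mulr1 ler_wpM2l//; exact: le_trans (ler_norm r) r1.
by rewrite ler_nat ltnn.
Qed.

(** * Bornological isomorphisms with free spaces *)

Section bornological_isomorphism.
Variables (R : realType) (E : tvsType R).

(** The isomorphism is the identity. A bounded set has bounded coordinates in a finite basis, hence
    stays bounded in the finest topology; the inverse is bounded since every neighborhood of zero in
    [E] is one in the finest topology. *)
Lemma born_iso_finest : hausdorff_space E ->
  (forall B : set E, tvs_bounded B -> lin_indep B -> finite_set B) ->
  born_iso E (finest E).
Proof.
move=> hE c2; exists (fun x : E => x : finest E), (fun x : finest E => x); split=> //.
- move=> B /[dup] bB /(bounded_finite_span c2)[n [b [bI Bb]]] U [V [cV bV aV VU]].
  have [M MB] := lincomb_bounded_coord hE bI bB.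
  have V0 := absorbing_set0 aV; have rP i := cid2 (aV (b i)).
  pose r i := s2val (rP i).
  have r0 i : 0 < r i by exact: (s2valP (rP i)).
  have rV i : V (r i *: b i).
    by apply: (s2valP' (rP i)); rewrite gtr0_norm.
  (* In terms of the vectors [r i *: b i] of [V], coordinates are at most M / r_i, so division by
     [k] makes them sum to at most 1. *)
  pose k := (Num.truncn (\sum_i M / r i)).+1.
  have k0 : 0 < k%:R :> R by rewrite ltr0n.
  exists k => _ [x Bx <-]; have [t _ tx] := Bb x Bx.
  exists (k%:R^-1 *: x); last by rewrite scalerA divff ?scale1r// gt_eqF.
  rewrite -[_ *: x]add0r; apply: VU; rewrite -tx /lincomb scaler_sumr.
  rewrite (eq_bigr (fun i => (k%:R^-1 * (t ord0 i / r i)) *: (r i *: b i))); last first.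
    by move=> i _; rewrite !scalerA -!mulrA mulVf ?mulr1// gt_eqF.
  apply: absconv_sum_le => //; apply: (@le_trans _ _ (k%:R^-1 * \sum_i M / r i)).
    rewrite mulr_sumr; apply: ler_sum => i _.
    rewrite !normrM !normfV (gtr0_norm k0) (gtr0_norm (r0 i)).
    apply: ler_wpM2l; first by rewrite invr_ge0 ltW.
    apply: ler_wpM2r; first by rewrite invr_ge0 ltW.
    by apply: le_trans (MB t _); [exact: rV_coord_le_norm|rewrite tx].
  by rewrite mulrC ler_pdivrMr// mul1r ltW// truncnS_gt.
- move=> B bB U /nbhs0_absconv[V [V0 cV bV VU]].
  have [|k Bk] := bB V.
    exists V; split; [exact: cV|exact: bV|exact: (nbhs0_absorbing V0)|].
    by move=> u; rewrite add0r.
  exists k => _ [x /Bk[v Vv vx] <-]; exists v => //; exact: VU.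
Qed.

Lemma cancel_linear (F : tvsType R) (f : E -> F) (g : F -> E) :
  linear f -> cancel f g -> cancel g f -> linear g.
Proof. by move=> lf fK gK a x y; apply: (can_inj fK); rewrite lf !gK. Qed.

Lemma born_iso_free_finite (F : tvsType R) (B : set E) :
  free_lcs F -> born_iso E F -> tvs_bounded B -> lin_indep B -> finite_set B.
Proof.
move=> freeF [f [g [lf fK gK bf bg]]] bB Bfree.
pose fl : {linear E -> F} := HB.pack f (GRing.isLinear.Build R E F _ f lf).
have -> : B = g @` (f @` B).
  by rewrite image_comp -[LHS]image_id; apply: eq_imagel => x _ /=; rewrite fK.
apply/finite_image/(free_bounded_finite freeF (bf B bB)) => s c us sB s0 x xs.
have sB' y : y \in map g s -> B y.
  by move=> /mapP[z /sB[w Bw <-] ->]; rewrite fK.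
rewrite -(gK x); apply: (Bfree (map g s) (c \o f)) => //; last exact: map_f.
  by rewrite map_inj_uniq//; exact: can_inj gK.
apply: (can_inj fK); rewrite -[f]/(fl : E -> F) linear_sum linear0 -[RHS]s0 big_map.
by apply: eq_bigr => y _; rewrite linearZ /= !gK.
Qed.

(** The set [U] is the preimage under the continuous map [f] of an absorbing absolutely convex set
    of [F]. *)
Lemma born_iso_free_bornological (F : tvsType R) :
  bornological E -> free_lcs F -> born_iso E F -> free_lcs E.
Proof.
move=> bornE freeF [f [g [lf fK gK bf bg]]] U /convex_setE cU bU aU.
have lg := cancel_linear lf fK gK.
pose gl : {linear F -> E} := HB.pack g (GRing.isLinear.Build R F E _ g lg).
pose fl : {linear E -> F} := HB.pack f (GRing.isLinear.Build R E F _ f lf).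
have f0 : f 0 = 0 by exact: (linear0 fl).
have gZ t x : g (t *: x) = t *: g x by exact: (linearZ_LR gl).
have nW : nbhs (f 0) (g @^-1` U).
  rewrite f0; apply: freeF.
  - apply/convex_setE => x y t t01 Ux Uy /=.
    by rewrite lg gZ; exact: cU.
  - by move=> t x t1 Ux /=; rewrite gZ; exact: bU.
  - by move=> x; have [r r0 rU] := aU (g x); exists r => // t /rU /=; rewrite gZ.
have nU : nbhs 0 (f @^-1` (g @^-1` U)) := bornE F f lf bf 0 _ nW.
by apply: filterS nU => x /=; rewrite fK.
Qed.

End bornological_isomorphism.

Theorem theorem2p1 (R : realType) (E : tvsType R) :
  hausdorff_space E ->
  let c1 := forall K : set E, compact K -> finite_top_dim K in
  let c2 := forall B : set E, tvs_bounded B -> lin_indep B -> finite_set B in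
  let c3 := exists F : tvsType R, free_lcs F /\ born_iso E F in
  [/\ c1 <-> c2, c2 <-> c3 & bornological E -> (c3 <-> free_lcs E)].
Proof.
move=> hE c1 c2 c3; split; first exact: finite_top_dim_bounded.
  split=> [|[F [freeF EF]] B]; last exact: born_iso_free_finite EF.
  by exists (finest E); split; [exact: finest_free|exact: born_iso_finest].
move=> bornE; split=> [[F [freeF EF]]|freeE].
  exact: born_iso_free_bornological EF.
by exists E; split=> //; exists id, id; split=> // B; rewrite image_id.
Qed.
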